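(* Let $G$ be a locally compact group and let $\mathcal{H} \subseteq \operatorname{Sub}(G)$ be a closed, (conjugation-)invariant subset. Then there exists a continuous action of $G$ on a compact space $X$ such that the stabilizer map $\operatorname{Stab} \colon X \to \operatorname{Sub}(G)$, $x \mapsto \{g \in G : gx = x\}$, is everywhere continuous and its image is equal to $\mathcal{H}$. If $G$ is second countable, $X$ can be chosen to be metrizable.
   Context: Locally compact groups and compact spaces are assumed Hausdorff. $\operatorname{Sub}(G)$ is the set of closed subgroups of $G$ with the Chabauty topology, which has as subbasis of open sets the sets $\{H \in \operatorname{Sub}(G) : H \cap C = \varnothing\}$ with $C \subseteq G$ compact, and $\{H \in \operatorname{Sub}(G) : H \cap V \neq \varnothing\}$ with $V \subseteq G$ open. It is a compact Hausdorff space on which $G$ acts continuously by conjugation; ''invariant'' means invariant under this conjugation action. A continuous action of $G$ on $X$ is one for which $G \times X \to X$ is continuous. *)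

(* Defs.v *)
From HB Require Import structures.
From mathcomp Require Import all_boot all_order all_algebra.
From mathcomp Require Import all_classical all_reals all_analysis.

Set Implicit Arguments.
Unset Strict Implicit.
Unset Printing Implicit Defensive.

Local Open Scope classical_set_scope.
Local Open Scope group_scope.

#[short(type="preTopologicalGroupType")]
HB.structure Definition PreTopologicalGroup := {G of Topological G & Group G}.

HB.mixin Record PreTopologicalGroup_isTopologicalGroup G
    & PreTopologicalGroup G := {
  mulg_continuous : continuous (fun x : G * G => x.1 * x.2) ;
  invg_continuous : continuous (fun x : G => x^-1)
}.

#[short(type="topologicalGroupType")]
HB.structure Definition TopologicalGroup :=
  {G of PreTopologicalGroup G & PreTopologicalGroup_isTopologicalGroup G}.

Record closed_subgroup (G : topologicalGroupType) := ClosedSubgroup {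
  subgroup_set :> set G ;
  subgroup1 : subgroup_set 1 ;
  subgroupM : forall x y, subgroup_set x -> subgroup_set y ->
    subgroup_set (x * y) ;
  subgroupV : forall x, subgroup_set x -> subgroup_set x^-1 ;
  subgroup_closed : closed subgroup_set
}.

HB.instance Definition _ (G : topologicalGroupType) :=
  gen_eqMixin (closed_subgroup G).
HB.instance Definition _ (G : topologicalGroupType) :=
  gen_choiceMixin (closed_subgroup G).

Section Chabauty.
Context {G : topologicalGroupType}.

Definition chabauty_miss (C : set G) : set (closed_subgroup G) :=
  [set H : closed_subgroup G | H `&` C = set0].

Definition chabauty_hit (V : set G) : set (closed_subgroup G) :=
  [set H : closed_subgroup G | H `&` V !=set0].

Definition chabauty_subbase : set (set (closed_subgroup G)) :=
  [set chabauty_miss C | C in @compact G] `|`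
  [set chabauty_hit V | V in @open G].

(* the Chabauty topology on [closed_subgroup G] *)
HB.instance Definition _ :=
  @isSubBaseTopological.Build (closed_subgroup G) (set (closed_subgroup G))
    chabauty_subbase id.

End Chabauty.

Section Conjugation.
Context {G : topologicalGroupType}.
Variables (g : G) (H : closed_subgroup G).

Definition conj_set : set G := [set g * h * g^-1 | h in H].

Lemma conj_setE : conj_set = (fun x => g^-1 * x * g) @^-1` H.
Proof.
apply/seteqP; split=> [_ [h Hh <-]|x Hx] /=.
  by rewrite !mulgA mulVg mul1g mulgVK.
by exists (g^-1 * x * g) => //; rewrite !mulgA mulgV mul1g mulgK.
Qed.

Lemma conj_set1 : conj_set 1.
Proof. by exists 1; [exact: subgroup1|rewrite mulg1 mulgV]. Qed.

Lemma conj_setM x y : conj_set x -> conj_set y -> conj_set (x * y).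
Proof.
move=> [h Hh <-] [k Hk <-]; exists (h * k); first exact: subgroupM.
by rewrite !mulgA mulgVK.
Qed.

Lemma conj_setV x : conj_set x -> conj_set x^-1.
Proof.
move=> [h Hh <-]; exists h^-1; first exact: subgroupV.
by rewrite !invgM invgK !mulgA.
Qed.

Lemma conj_set_closed : closed conj_set.
Proof.
rewrite conj_setE; apply: preimage_closed; last exact: subgroup_closed.
move=> x _; apply: (continuous_comp (f := fun x : G => (g^-1 * x, g))
  (g := fun p : G * G => p.1 * p.2)); last exact: mulg_continuous.
apply: cvg_pair => /=; last exact: cvg_cst.
apply: (continuous_comp (f := fun x : G => (g^-1, x))
  (g := fun p : G * G => p.1 * p.2)); last exact: mulg_continuous.
by apply: cvg_pair => /=; [exact: cvg_cst|exact: cvg_id].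
Qed.

Definition conj_subgroup : closed_subgroup G :=
  ClosedSubgroup conj_set1 conj_setM conj_setV conj_set_closed.

End Conjugation.

Definition conj_invariant (G : topologicalGroupType)
    (HH : set (closed_subgroup G)) :=
  forall (g : G) (H : closed_subgroup G), HH H -> HH (conj_subgroup g H).

Record continuous_action (G : topologicalGroupType) (X : topologicalType) :=
  ContinuousAction {
  act :> G -> X -> X ;
  act1 : forall x, act 1 x = x ;
  actM : forall g h x, act (g * h) x = act g (act h x) ;
  act_continuous : continuous (fun p : G * X => act p.1 p.2)
}.

(* X is assumed Hausdorff so that stabilizers are closed subgroups *)
Section Stabilizer.
Context {G : topologicalGroupType} {X : topologicalType}.
Hypothesis hausX : hausdorff_space X.
Variables (a : continuous_action G X) (x : X).

Definition stab_set : set G := [set g | a g x = x].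

Lemma stab_set1 : stab_set 1.
Proof. exact: act1. Qed.

Lemma stab_setM g h : stab_set g -> stab_set h -> stab_set (g * h).
Proof. by rewrite /stab_set /= actM => gx ->. Qed.

Lemma stab_setV g : stab_set g -> stab_set g^-1.
Proof. by move=> gx; rewrite /stab_set /= -{1}gx -actM mulVg act1. Qed.

Lemma stab_set_closed : closed stab_set.
Proof.
rewrite (_ : stab_set = (a^~ x) @^-1` [set x]) //.
apply: preimage_closed.
  move=> g _; apply: (continuous_comp (f := fun g : G => (g, x))
    (g := fun p : G * X => a p.1 p.2)); last exact: act_continuous.
  by apply: cvg_pair => /=; [exact: cvg_id|exact: cvg_cst].
exact/accessible_closed_set1/hausdorff_accessible.
Qed.

Definition stab : closed_subgroup G :=
  ClosedSubgroup stab_set1 stab_setM stab_setV stab_set_closed.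

End Stabilizer.

Definition metrizable (R : realType) (X : topologicalType) :=
  exists (M : metricType R) (f : X -> M) (g : M -> X),
    [/\ cancel f g, cancel g f, continuous f & continuous g].

(* Main.v *)
(* For each pair t = (K, L) of compact sets with K inside the interior of L,
   finitely many functions G -> [0, 1] colour the right cosets of a closed
   subgroup H so that x and xk get well-separated values for all k in K,
   whenever Hx does not meet xL. They are built from a bump function f placed
   at the points of a maximal E-separated subset of H\G, coloured so that points
   of the same colour are W-apart; the number of colours needed and the modulus
   of (left-)uniform continuity rho come from K, L and f only, not from H.
   Hence the colourings of all H in HH form a closed set of pairs (H, c) for the
   product of the Chabauty and pointwise topologies, and the colourings c
   themselves form a compact space X. Uniform continuity makes left translation
   a jointly continuous action on X. A colouring c of H is fixed exactly by H,
   so X is in bijection with the compact space of pairs (H, c), whence the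
   stabilizer map is continuous. If G is second countable, countably many pairs
   t and a dense sequence of points of G suffice to separate the points of X. *)
From HB Require Import structures.
Require Import Defs.
From mathcomp Require Import all_boot all_order all_algebra finmap lra.
From mathcomp Require Import all_classical all_reals all_analysis.

Set Implicit Arguments.
Unset Strict Implicit.
Unset Printing Implicit Defensive.

Import Order.TTheory GRing.Theory Num.Theory.
Import numFieldNormedType.Exports.

Local Open Scope classical_set_scope.
Local Open Scope group_scope.

(** * Compactness of the Chabauty space *)

Section chabauty_topology.
Context {G : topologicalGroupType}.
Implicit Types H : closed_subgroup G.

Lemma open_chabauty_subbase (A : set (closed_subgroup G)) :
  chabauty_subbase A -> open A.
Proof.
move=> sA; exists [set A]; last by rewrite bigcup_set1.
move=> _ ->; exists [fset A]%fset; first by move=> B /fset1P ->; rewrite inE.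
by rewrite set_fset1 bigcap_set1.
Qed.

Lemma open_chabauty_hit (V : set G) : open V -> open (chabauty_hit V).
Proof. by move=> oV; apply: open_chabauty_subbase; right; exists V. Qed.

Lemma open_chabauty_miss (C : set G) : compact C -> open (chabauty_miss C).
Proof. by move=> cC; apply: open_chabauty_subbase; left; exists C. Qed.

Lemma cvg_chabauty (F : set_system (closed_subgroup G)) H : Filter F ->
  (forall V, open V -> chabauty_hit V H -> F (chabauty_hit V)) ->
  (forall C, compact C -> chabauty_miss C H -> F (chabauty_miss C)) ->
  F --> H.
Proof.
move=> FF Fhit Fmiss A; rewrite nbhsE/= => -[B [[D' D'base <-]]].
case=> U D'U UH UA.
apply: filterS (fun K UK => UA K (ex_intro2 _ _ U D'U UK)) _.
have [D Dbase DU] := D'base _ D'U; move: UH; rewrite -DU => DH.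
apply: filter_bigI => A' A'D; have := DH _ A'D => /=.
by have := Dbase _ A'D; rewrite inE => -[[C cC <-]|[V oV <-]];
  [exact: Fmiss|exact: Fhit].
Qed.

Section ultra_limit.
Variables (F : set_system (closed_subgroup G)) (FU : UltraFilter F).

(** The candidate limit of [F], a lower limit in the sense of Kuratowski; it satisfies the hit
    conditions by construction. *)
Let lim_set : set G := [set x | forall V, open_nbhs x V -> F (chabauty_hit V)].

Let lim_set1 : lim_set 1.
Proof.
move=> V [oV V1]; apply: filterS filterT => H _.
by exists 1; split => //; exact: subgroup1.
Qed.

Let lim_setM x y : lim_set x -> lim_set y -> lim_set (x * y).
Proof.
move=> Fx Fy V oV; have := @mulg_continuous G (x, y) _ (open_nbhs_nbhs oV).
case=> -[/= A B] []; rewrite !nbhsE => -[A' oA A'A] [B' oB B'B] ABV.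
apply: filterS (filterI (Fx _ oA) (Fy _ oB)) => H [[u [Hu A'u]] [v [Hv B'v]]].
exists (u * v); split; first exact: subgroupM.
by apply: (ABV (u, v)); split; [exact: A'A|exact: B'B].
Qed.

Let lim_setV x : lim_set x -> lim_set x^-1.
Proof.
move=> Fx V oV; have := @invg_continuous G x _ (open_nbhs_nbhs oV).
rewrite /= nbhsE => -[A oA AV]; apply: filterS (Fx _ oA) => H [u [Hu Au]].
by exists u^-1; split; [exact: subgroupV|exact: AV].
Qed.

Let lim_set_closed : closed lim_set.
Proof.
move=> x clx V oV; have [y [Fy Vy]] := clx _ (open_nbhs_nbhs oV).
by apply: Fy; split => //; case: oV.
Qed.

(** Only the miss sets need work. A point of [C] outside the limit has an open neighbourhood that
    [F]-almost every subgroup misses, because an ultrafilter decides every set; compactness of [C]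
    makes this uniform. *)
Lemma chabauty_ultra_cvg : exists H, F --> H.
Proof.
exists (ClosedSubgroup lim_set1 lim_setM lim_setV lim_set_closed).
apply: cvg_chabauty => [V oV [x [Fx Vx]]|C cC CH]; first exact: Fx.
have : F [set H : closed_subgroup G | C `<=` ~` H].
  move/compact_near_coveringP : cC; apply => x Cx.
  have /existsNP[V /not_implyP[oV FV]] : ~ lim_set x.
    by move=> Fx; suff : set0 x by []; rewrite -CH.
  have [//|FVC] := in_ultra_setVsetC (chabauty_hit V) FU.
  exists (V, ~` chabauty_hit V); first by split => //; exact: open_nbhs_nbhs.
  by move=> [y H] [/= Vy VH Hy]; apply: VH; exists y.
by apply: filterS => H CnH; rewrite /chabauty_miss/= -subset0 => x [Hx /CnH].
Qed.

End ultra_limit.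

Lemma chabauty_compact : compact [set: closed_subgroup G].
Proof.
rewrite compact_ultra => F FU _.
by have [H FH] := chabauty_ultra_cvg FU; exists H.
Qed.

End chabauty_topology.

(** * Separated nets in the coset space *)

(** Zorn's lemma for unions of chains; [r] may fail to be reflexive, hence the condition [r x x]. *)
Lemma exists_maximal_clique T (r : T -> T -> Prop) :
  (forall s t, r s t -> r t s) ->
  exists S : set T, (forall s t, S s -> S t -> r s t) /\
    forall x, r x x -> (forall s, S s -> r s x) -> S x.
Proof.
move=> rC; pose clique S := forall s t : T, S s -> S t -> r s t.
have [S [cS maxS]] : exists S, clique S /\ forall B, S `<` B -> ~ clique B.
  apply: Zorn_bigcup => F Fclique Ftot s t [A FA As] [B FB Bt].
  have [AB|BA] := Ftot _ _ FA FB.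
    by apply: (Fclique _ FB) => //; exact: AB.
  by apply: (Fclique _ FA) => //; exact: BA.
exists S; split=> // x rxx rSx; apply: contrapT => nSx.
apply: (maxS (S `|` [set x])).
  by split=> [s Ss|/(_ x (or_intror erefl))//]; left.
by move=> s t [Ss|->] [St|->] //; [exact: cS|exact: rSx|apply/rC/rSx].
Qed.

Section topological_group.
Context {G : topologicalGroupType}.

Lemma cvgMg T (F : set_system T) (f g : T -> G) a b : Filter F ->
  f @ F --> a -> g @ F --> b -> f x * g x @[x --> F] --> a * b.
Proof.
move=> FF fa gb.
apply: (@cvg_comp _ _ _ (fun x => (f x, g x)) (fun p : G * G => p.1 * p.2)).
  exact: cvg_pair fa gb.
exact: (@mulg_continuous G (a, b)).
Qed.

Lemma cvgVg T (F : set_system T) (f : T -> G) a : Filter F ->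
  f @ F --> a -> (f x)^-1 @[x --> F] --> a^-1.
Proof.
move=> FF fa; apply: (@cvg_comp _ _ _ f (fun x : G => x^-1)); first exact: fa.
exact: invg_continuous.
Qed.

Lemma nbhs1V (A : set G) : nbhs (1 : G) A -> \forall u \near (1 : G), A u^-1.
Proof. by rewrite -{1}invg1 => /(@invg_continuous G). Qed.

Lemma compact_mul (A B : set G) : compact A -> compact B ->
  compact [set x.1 * x.2 | x in A `*` B].
Proof.
move=> cA cB; apply: continuous_compact; last exact: compact_setX.
exact/continuous_subspaceT/mulg_continuous.
Qed.

Lemma compact_inv (A : set G) : compact A -> compact [set x^-1 | x in A].
Proof.
move=> cA; apply: continuous_compact => //.
exact/continuous_subspaceT/invg_continuous.
Qed.

(** Choose [D] with [D^-1 D] inside [E] and cover [W] by finitely many translates of [D]: with one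
    point more than translates, two points share a translate. This [N] becomes the number of
    colours. *)
Lemma compact_pigeonhole (W E : set G) : compact W -> nbhs 1 E ->
  exists N, forall f : 'I_N -> G, (forall i, W (f i)) ->
    exists i j, i != j /\ E ((f i)^-1 * f j).
Proof.
move=> cW E1.
have [D D1 DE] : exists2 D, open_nbhs 1 D &
    forall u v, D u -> D v -> E (u^-1 * v).
  have : u.1^-1 * u.2 @[u --> nbhs ((1 : G), (1 : G))] --> 1^-1 * (1 : G).
    by apply: cvgMg; [apply: cvgVg; exact: cvg_fst|exact: cvg_snd].
  rewrite invg1 mul1g => /(_ _ E1)[[A B] [/= A1 B1] ABE].
  have [D D1 DAB] : exists2 D, open_nbhs 1 D & D `<=` A `&` B.
    have : nbhs (1 : G) (A `&` B) by exact: filterI.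
    by rewrite nbhsE.
  by exists D => // u v /DAB[Au _] /DAB[_ Bv]; exact: (ABE (u, v)).
pose G' : ptopologicalType := HB.pack (G : Type) G (isPointed.Build G 1).
have : @cover_compact G' W by rewrite -compact_cover.
move=> /(_ G [set: G] (fun z => (fun x => z^-1 * x) @^-1` D)).
case=> [z _| |D' _ WD'].
- apply: (@open_comp G G); last by case: D1.
  move=> x _; apply: (@cvgMg G (nbhs x) (fun=> z^-1) id); first exact: cvg_cst.
  exact: cvg_id.
- by move=> x Wx; exists x => //=; rewrite mulVg; case: D1.
exists #|` D'|.+1 => f Wf.
have /choice[g gP] i : exists z : D', D ((val z)^-1 * f i).
  by have [z zD' Dz] := WD' _ (Wf i); exists [`zD']%fset.
have /injectivePn[i [j ij gij]] : ~~ injectiveb g.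
  by apply/negP => /injectiveP/leq_card; rewrite card_ord cardfE ltnn.
exists i, j; split=> //.
by have := DE _ _ (gP i) (gP j); rewrite gij invgM invgK mulgA mulgK.
Qed.

(** [S i] holds the net points of colour [i]. The net is a maximal clique of coloured points, so a
    point far from it must be blocked in each of the [N] colours. *)
Lemma exists_separated_net (H : closed_subgroup G) (E W : set G) N :
  E 1 -> (forall u, E u -> E u^-1) -> (forall u, W u -> W u^-1) ->
  (forall f : 'I_N -> G, (forall i, W (f i)) ->
    exists i j, i != j /\ E ((f i)^-1 * f j)) ->
  exists S : 'I_N -> set G,
    (forall i (a b h : G), S i a -> S i b -> subgroup_set H h ->
      W (a^-1 * h * b) -> subgroup_set H (b * a^-1)) /\
    forall x, exists i (a h : G),
      [/\ S i a, subgroup_set H h & E (a^-1 * h * x)].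
Proof.
(* Points that are [E]-close modulo [H] must agree in colour; points of one colour that are
   [W]-close modulo [H] must lie in the same right coset. *)
move=> E1 EV WV pigeon; pose r (s t : G * 'I_N) :=
  (forall h : G, subgroup_set H h -> E (s.1^-1 * h * t.1) -> s.2 = t.2) /\
  (s.2 = t.2 -> forall h : G, subgroup_set H h -> W (s.1^-1 * h * t.1) ->
    subgroup_set H (t.1 * s.1^-1)).
have rC s t : r s t -> r t s.
  case=> rE rW; split=> [h Hh /EV Eh|/esym st h Hh /WV Wh].
    apply/esym/(rE h^-1); first exact: subgroupV.
    by move: Eh; rewrite !invgM invgK mulgA.
  rewrite -[s.1 * _]invgK invgM invgK; apply/subgroupV/(rW st h^-1).
    exact: subgroupV.
  by move: Wh; rewrite !invgM invgK mulgA.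
have [S [cS maxS]] := exists_maximal_clique rC.
exists (fun i => [set a | S (a, i)]); split=> [i a b h Sa Sb Hh Wh|x].
  by have [_ /(_ erefl h Hh Wh)] := cS _ _ Sa Sb.
apply: contrapT => noE.
have {}noE i a h : S (a, i) -> subgroup_set H h -> ~ E (a^-1 * h * x).
  by move=> Sa Hh Eh; apply: noE; exists i, a, h.
have /choice[f fP] i : exists a, S (a, i) /\
    exists2 h : G, subgroup_set H h & W (x^-1 * h * a).
  have : ~ S (x, i).
    move=> Sx; apply: (noE i x 1) => //; first exact: subgroup1.
    by rewrite mulg1 mulVg.
  apply: contra_notP => /forallNP noW; apply: maxS.
    by split=> // _ h _ _ /=; rewrite mulgV; exact: subgroup1.
  move=> [a j] Sa; split=> /= [h Hh /(noE _ _ _ Sa Hh)//|ji h Hh Wh].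
  exfalso; apply: (noW a); split; first by rewrite -ji.
  exists h^-1; first exact: subgroupV.
  by move: Wh => /WV; rewrite !invgM invgK mulgA.
have /choice[g gP] i : exists h : G, subgroup_set H h /\ W (x^-1 * h * f i).
  by have [_ [h Hh Wh]] := fP i; exists h.
(* Each colour i is blocked at x by a point f i; by the pigeonhole principle two
   of these are E-close modulo H, contradicting the separation of colours. *)
have [i [j [/eqP ij Eij]]] := pigeon _ (fun i => (gP i).2).
apply: ij; have [+ _] := cS _ _ (fP i).1 (fP j).1.
apply; first exact: subgroupM (subgroupV (gP i).1) (gP j).1.
by move: Eij; rewrite !invgM invgK !mulgA mulgK.
Qed.

End topological_group.

(** * Uniformly continuous colourings *)

Lemma compact_nbhs_in (T : topologicalType) (x : T) (U : set T) :
  hausdorff_space T -> locally_compact [set: T] -> nbhs x U ->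
  exists C, [/\ compact C, nbhs x C & C `<=` U].
Proof.
move=> hausT /(_ x I); rewrite withinET => -[A Ax [cA _]] Ux.
have [B Bx BU] : exists2 B, nbhs x B & closure B `<=` A `&` U.
  by apply: (compact_regular hausT cA Ax); exact: filterI.
exists (closure B); split.
- apply: subclosed_compact cA _; first exact: closed_closure.
  by move=> y /BU[].
- exact: filterS (@subset_closure _ B) Bx.
- by move=> y /BU[].
Qed.

Lemma exists_bump (R : realType) (T : topologicalType) (x : T) (Q : set T) :
  hausdorff_space T -> locally_compact [set: T] -> nbhs x Q ->
  exists f : T -> R, [/\ continuous f, forall y, (0 <= f y <= 1)%R,
    f x = 1%R & forall y, ~ Q y -> f y = 0%R].
Proof.
move=> hausT lcT Qx.
have := @locally_compact_completely_regular T R lcT hausT x (~` Q°).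
have cQ : closed (~` Q°) by apply: open_closedC; exact: open_interior.
move=> /(_ cQ (fun h => h Qx))/(uniform_separatorP (R := R))[f [cf f01 fx fQ]].
exists (fun y => 1 - f y)%R; split=> [y|y||y nQy].
- by apply: cvgB; [exact: cvg_cst|exact: cf].
- have := f01 (f y); rewrite /= in_itv/= => /(_ (ex_intro2 _ _ y I erefl)).
  by rewrite subr_ge0 lerBlDr lerDl => /andP[-> ->].
- by rewrite (fx (f x)) ?subr0//; exists x.
- have -> : f y = 1%R; last by rewrite subrr.
  by apply: (fQ (f y)); exists y => // /interior_subset.
Qed.

Section left_modulus.
Context {R : realType} {G : topologicalGroupType}.

(** As [u] multiplies on the right, all left translates of [f] share this modulus, so that one [rho]
    serves all bumps and all subgroups. *)
Definition left_modulus (f : G -> R) (u : G) : R :=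
  sup [set `|f (z * u)%g - f z|%R | z in [set: G]].

Variables (f : G -> R) (f01 : forall x, (0 <= f x <= 1)%R).

Lemma left_modulusP z u : (`|f (z * u)%g - f z| <= left_modulus f u)%R.
Proof.
apply: ub_le_sup; last by exists z.
exists 1%R => _ [y _ <-]; have := f01 (y * u)%g; have := f01 y.
by rewrite ler_norml => /andP[? ?] /andP[? ?]; apply/andP; split; lra.
Qed.

(** Compactness gives a neighbourhood of 1 that works for all [z] in [Q]. If only [z * u] lies in
    [Q], the estimate is applied there with [u^-1]; if neither does, both values vanish. *)
Lemma left_modulus_cvg (Q : set G) : continuous f -> compact Q ->
  (forall x, ~ Q x -> f x = 0%R) ->
  left_modulus f u @[u --> (1 : G)] --> 0%R.
Proof.
move=> cf cQ f0; apply/cvgr0Pnorm_le => e e0.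
have unifQ : \forall u \near (1 : G),
    Q `<=` [set z | (`|f (z * u)%g - f z| <= e)%R].
  move/compact_near_coveringP : cQ; apply => x Qx.
  have : (f (p.1 * p.2)%g - f p.1)%R @[p --> (x, (1 : G))] -->
      (f (x * 1)%g - f x)%R.
    apply: cvgB; last first.
      by apply: (@cvg_comp _ _ _ fst f); [exact: cvg_fst|exact: cf].
    apply: (@cvg_comp _ _ _ (fun p : G * G => (p.1 * p.2)%g) f); last exact: cf.
    by apply: cvgMg; [exact: cvg_fst|exact: cvg_snd].
  by rewrite mulg1 subrr => /cvgr0Pnorm_le; exact.
have unifQV : \forall u \near (1 : G),
    Q `<=` [set z | (`|f (z * u^-1)%g - f z| <= e)%R].
  exact: nbhs1V unifQ.
near=> u; rewrite ger0_norm; last exact: le_trans (left_modulusP 1 u).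
apply: ge_sup; first by exists `|f (1 * u)%g - f 1%g|%R, 1.
move=> _ [z _ <-]; have [Qz|nQz] := pselect (Q z).
  by move: z Qz; near: u.
have [Qzu|nQzu] := pselect (Q (z * u)%g).
  rewrite distrC -{1}(mulgK u z).
  by move: (z * u)%g Qzu; near: u.
by rewrite !f0// subrr normr0 ltW.
Unshelve. all: by end_near. Qed.

End left_modulus.

Section coloring.
Context {R : realType} {G : topologicalGroupType}.
Hypotheses (hausG : hausdorff_space G) (lcG : locally_compact [set: G]).

(** [c i x] is the supremum of the bumps [f (a^-1 * h * x)] over net points [a] of colour [i] and
    [h] in [H]. A net point near [x] makes it at least 1/2 for some [i], and for this [i] the value
    at [x * k] is 0. *)
Lemma exists_left_coloring (K L : set G) : compact K ->
  (forall k, K k -> nbhs k L) ->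
  exists rho : G -> R, exists N : nat, rho u @[u --> (1 : G)] --> 0%R /\
    forall H : closed_subgroup G, exists c : nat -> G -> R,
    [/\ forall i x, (0 <= c i x <= 1)%R,
        forall i x u, (`|c i (x * u)%g - c i x| <= rho u)%R,
        forall i h x, subgroup_set H h -> c i (h * x)%g = c i x &
        forall x, (forall h, subgroup_set H h -> ~ L (x^-1 * h * x)%g) ->
          exists i : 'I_N,
            forall k, K k -> (1 / 2 <= `|c i (x * k)%g - c i x|)%R].
Proof.
move=> cK KL.
have [Q [cQ Q1 KQL]] : exists Q : set G, [/\ compact Q, nbhs 1 Q &
    forall k q v, K k -> Q q -> Q v -> L (k * q^-1 * v)].
  have : \forall p \near ((1 : G), (1 : G)),
      K `<=` [set k | L (k * p.1^-1 * p.2)].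
    have /compact_near_coveringP cvK := cK.
    have FF : Filter (nbhs ((1 : G), (1 : G))) by exact: nbhs_filter.
    pose P (p : G * G) k := L (k * p.1^-1 * p.2).
    apply: (cvK _ _ P FF) => k Kk.
    suff : p.1 * p.2.1^-1 * p.2.2 @[p --> (k, ((1 : G), (1 : G)))] -->
        k * 1^-1 * 1.
      by rewrite invg1 !mulg1 => /(_ _ (KL k Kk)).
    apply: cvgMg; first apply: cvgMg.
    - exact: cvg_fst.
    - apply: cvgVg; apply: (@cvg_comp _ _ _ snd fst); first exact: cvg_snd.
      exact: cvg_fst.
    - apply: (@cvg_comp _ _ _ snd snd); first exact: cvg_snd.
      exact: cvg_snd.
  case=> -[A B] [/= A1 B1] ABL.
  have [|Q [cQ Q1 QAB]] := @compact_nbhs_in G 1 (A `&` B) hausG lcG.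
    exact: filterI.
  exists Q; split=> // k q v Kk /QAB[Aq _] /QAB[_ Bv].
  exact: (ABL (q, v)).
have [f [cf f01 f1 fQ]] := @exists_bump R G 1 Q hausG lcG Q1.
pose E := [set u | (1 / 2 < f u)%R] `&` [set u | (1 / 2 < f (u^-1)%g)%R].
(* [W0] is [Q K Q^-1]: it contains [a^-1 * h * h'^-1 * b] whenever [a^-1 * h * x] and
   [b^-1 * h' * (x * k)] lie in [Q]. *)
pose W0 := [set x.1 * x.2 | x in
  [set x.1 * x.2 | x in Q `*` K] `*` [set x^-1 | x in Q]].
pose W := W0 `|` [set x^-1 | x in W0].
have cW : compact W.
  have cW0 : compact W0.
    by apply: compact_mul; [exact: compact_mul|exact: compact_inv].
  by apply: compactU => //; exact: compact_inv.
have E1 : nbhs (1 : G) E.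
  have f12 : nbhs (1 : G) [set u | (1 / 2 < f u)%R].
    by apply: (cvgr_gt (f 1)); [exact: cf|rewrite f1; lra].
  by apply: filterI => //; exact: nbhs1V f12.
have EQ v : E v -> Q v.
  by case=> fv _; apply: contrapT => /fQ fv0; move: fv; rewrite /= fv0; lra.
have EV v : E v -> E v^-1 by case=> ? ?; split; rewrite //= invgK.
have WV v : W v -> W v^-1.
  by case=> [Wv|[w Ww <-]]; [right; exists v|left; rewrite invgK].
have [N pigeon] := compact_pigeonhole cW E1.
exists (left_modulus f), N; split; first exact: left_modulus_cvg cf cQ fQ.
move=> H.
have [S [Ssep Snet]] :=
  exists_separated_net H (nbhs_singleton E1) EV WV pigeon.
(* Including 0 keeps the set nonempty and makes the colours from [N] on constantly 0. *)
pose V i x : set R := [set r | r = 0%R \/ exists j : 'I_N, i = j :> nat /\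
  exists a h, [/\ S j a, subgroup_set H h & r = f (a^-1 * h * x)]].
have V0 i x : V i x !=set0 by exists 0%R; left.
have V01 i x r : V i x r -> (0 <= r <= 1)%R.
  by case=> [->|[j [_ [a [h [_ _ ->]]]]]]; [rewrite lexx ler01|exact: f01].
have Vub i x : has_ubound (V i x) by exists 1%R => r /V01 /andP[].
have c01 i x : (0 <= sup (V i x) <= 1)%R.
  apply/andP; split; first by apply: ub_le_sup => //; left.
  by apply: ge_sup => // r /V01 /andP[].
have cle i x y r : (0 <= r)%R ->
    (forall z, (f (z * x)%g <= f (z * y)%g + r)%R) ->
    (sup (V i x) <= sup (V i y) + r)%R.
  move=> r0 fxy; apply: ge_sup => // _ [->|[j [ij [a [h [Sja Hh ->]]]]]].
    by have /andP[c0 _] := c01 i y; exact: addr_ge0.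
  apply: le_trans (fxy _) _; rewrite lerD2r; apply: ub_le_sup => //.
  by right; exists j; split => //; exists a, h.
exists (fun i x => sup (V i x)); split=> //.
- move=> i x u.
  have rho0 : (0 <= left_modulus f u)%R.
    exact: le_trans (normr_ge0 _) (left_modulusP f01 x u).
  have rhoP z : (`|f (z * (x * u))%g - f (z * x)%g| <= left_modulus f u)%R.
    by rewrite mulgA; exact: left_modulusP.
  have h1 : (sup (V i (x * u)%g) <= sup (V i x) + left_modulus f u)%R.
    by apply: cle => // z; have := rhoP z; rewrite ler_norml => /andP[_ ?]; lra.
  have h2 : (sup (V i x) <= sup (V i (x * u)%g) + left_modulus f u)%R.
    by apply: cle => // z; have := rhoP z; rewrite ler_norml => /andP[? _]; lra.
  by rewrite ler_norml; apply/andP; split; lra.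
- move=> i h x Hh; congr sup; apply/seteqP; split=> r;
    (case=> [->|[j [ij [a [k [Sja Hk ->]]]]]];
     [by left|right; exists j; split=> //]).
  + exists a, (k * h); split=> //; first exact: subgroupM.
    by rewrite !mulgA.
  + exists a, (k * h^-1); split=> //; first exact: subgroupM (subgroupV _).
    by rewrite !mulgA mulgVK.
- move=> x HL; have [i [a [h [Sia Hh Eh]]]] := Snet x.
  exists i => k Kk.
  have : (1 / 2 <= sup (V i x))%R.
    case: Eh => /ltW + _; move/le_trans; apply; apply: ub_le_sup => //.
    by right; exists i; split=> //; exists a, h.
  (* A bump at [b] of colour [i] that is nonzero at [x * k] would be [W]-close to [a] modulo [H],
     hence in the same coset. *)
  have -> : sup (V i (x * k)) = 0%R.
    rewrite (_ : V _ _ = [set 0%R]) ?sup1//.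
    apply/seteqP; split=> [r|_ ->]; last by left.
    case=> [//|[j [/ord_inj <- [b [h' [Sib Hh' ->]]]]]].
    apply: fQ => Qb.
    have Hba : subgroup_set H (b * a^-1).
      apply: (Ssep i a b (h * h'^-1)) => //.
        by apply: subgroupM => //; exact: subgroupV.
      left; exists (a^-1 * h * x * k, (b^-1 * h' * (x * k))^-1).
        split; last by exists (b^-1 * h' * (x * k)).
        by exists (a^-1 * h * x, k) => //; split=> //; exact: EQ.
      by rewrite /= !invgM !invgK !mulgA !(mulgK, mulgVK).
    (* [k * q^-1 * v] telescopes to a conjugate by [x] of an element of [H], and lies in [L] by the
       choice of [Q]. *)
    pose q := b^-1 * h' * (x * k); pose v := a^-1 * h * x.
    apply: (HL (h'^-1 * (b * a^-1) * h)).
      by apply: subgroupM => //; apply: subgroupM => //; exact: subgroupV.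
    have := KQL k q v Kk Qb (EQ _ Eh).
    by rewrite /q /v !invgM !invgK !mulgA mulgV mul1g.
  by move=> ?; rewrite sub0r normrN ger0_norm//; lra.
Qed.

End coloring.

(** * The space of pairs (subgroup, colouring) *)

Lemma ptws_eval_continuous (I : eqType) (Y : topologicalType) (i : I) :
  continuous (fun f : {ptws I -> Y} => f i).
Proof. exact: (@proj_continuous I (fun=> Y) i). Qed.

Lemma continuous_ptws (X Y : topologicalType) (I : Type)
  (f : X -> {ptws I -> Y}) : (forall i, continuous (f^~ i)) -> continuous f.
Proof.
move=> cf x; apply/cvg_sup => i.
by apply: continuous_comp_initial; exact: cf.
Qed.

Lemma continuous_subtype (X Y : topologicalType) (A : set Y) (f : X -> A) :
  continuous (fun x => \val (f x)) -> continuous f.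
Proof. by move=> cf; apply: continuous_comp_initial. Qed.

Lemma subtype_val_continuous (Y : topologicalType) (A : set Y) :
  continuous (fun x : A => \val x).
Proof. exact: initial_continuous. Qed.

Lemma subtype_hausdorff (Y : topologicalType) (A : set Y) :
  hausdorff_space Y -> hausdorff_space A.
Proof.
move=> hausY x y xy; apply/val_inj/hausY => B C Bx Cy.
have [z [Bz Cz]] :=
  xy _ _ (subtype_val_continuous Bx) (subtype_val_continuous Cy).
by exists (\val z).
Qed.

Lemma subtype_compact (Y : topologicalType) (A : set Y) :
  compact A -> compact [set: A].
Proof.
move=> cA F PF _.
have [|x [Ax clx]] := cA (fmap (fun a : A => \val a) F)
    (fmap_proper_filter _ PF).
  by apply: (@filterS _ F _ setT) => [a _|]; [exact: set_valP|exact: filterT].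
exists (SigSub (mem_set Ax)); split=> // B C FB [_ [[W oW <-] Wx WC]].
have FvB : F ((fun a : A => \val a) @^-1` [set \val b | b in B]).
  by apply: filterS FB => b Bb; exists b.
have [_ [[b Bb <-] Wb]] := clx _ W FvB (open_nbhs_nbhs (conj oW Wx)).
by exists b; split=> //; exact: WC.
Qed.

Section configurations.
Context {R : realType} {G : topologicalGroupType} {T : choiceType}.
Variables (rho : T -> G -> R) (N : T -> nat) (K L : T -> set G).

(** The coordinates are pair index, colour and point. Colours range over all naturals, so that the
    index type does not depend on [N]. *)
Definition config := {ptws (T * nat * G)%type -> R}.

Definition left_equivariant (H : closed_subgroup G) (c : config) := [/\
  forall s, (0 <= c s <= 1)%R,
  forall t i x u, (`|c (t, i, (x * u)%g) - c (t, i, x)| <= rho t u)%R,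
  forall t i h x, subgroup_set H h -> c (t, i, (h * x)%g) = c (t, i, x) &
  forall t x, (forall h, subgroup_set H h -> ~ L t (x^-1 * h * x)%g) ->
    exists i : 'I_(N t), forall k, K t k ->
      (1 / 2 <= `|c (t, val i, (x * k)%g) - c (t, val i, x)|)%R].

Hypothesis rho0 : forall t, rho t u @[u --> (1 : G)] --> 0%R.
Hypothesis compactL : forall t, compact (L t).
Hypothesis KLfine : forall (g : G) U, nbhs g U -> exists t, K t g /\ L t `<=` U.

(** If [g] is outside [H], some pair has [g] in [K t] and [L t] disjoint from [H]. Separation at
    [x = 1] with [k = g] then distinguishes [g] from 1, which invariance under [g] forbids. *)
Lemma left_equivariant_stab H c g : left_equivariant H c ->
  subgroup_set H g <-> forall t i x, c (t, i, (g^-1 * x)%g) = c (t, i, x).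
Proof.
case=> _ _ cH csep; split=> [Hg t i x|gc].
  by apply: cH; exact: subgroupV.
apply: contrapT => nHg.
have [t [Kg LH]] : exists t, K t g /\ L t `<=` ~` H.
  apply/KLfine/open_nbhs_nbhs; split=> //.
  exact/closed_openC/subgroup_closed.
have [|i ci] := csep t 1.
  by move=> h Hh; rewrite invg1 mul1g mulg1 => /LH.
have := ci _ Kg; rewrite mul1g -(gc _ _ g) (mulVg g) subrr normr0; lra.
Qed.

Definition shift_config (g : G) (c : config) : config :=
  fun s => c (s.1, (g^-1 * s.2)%g).

(** Left translation commutes with right multiplication by [u] and [k], and conjugating
    [g * h * g^-1] by [x] is conjugating [h] by [g^-1 * x]. *)
Lemma left_equivariant_shift H c g : left_equivariant H c ->
  left_equivariant (conj_subgroup g H) (shift_config g c).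
Proof.
case=> c01 clip cH csep; split=> [s|t i x u|t i _ x [h Hh <-]|t x xL].
- exact: c01.
- by rewrite /shift_config/= mulgA; exact: clip.
- rewrite /shift_config/= -(cH t i h (g^-1 * x)%g Hh); congr (c (_, _)).
  by rewrite !mulgA mulVg mul1g.
- have [|i ci] := csep t (g^-1 * x).
    move=> h Hh; rewrite invgM invgK => Lh.
    apply: (xL (g * h * g^-1)); first by exists h.
    by move: Lh; rewrite !mulgA.
  by exists i => k Kk; rewrite /shift_config/= mulgA; exact: ci.
Qed.

Variables (HH : set (closed_subgroup G)) (clHH : closed HH).

Definition configs : set (closed_subgroup G * config) :=
  [set p | HH p.1 /\ left_equivariant p.1 p.2].

Let config_eval_cvg (p : closed_subgroup G * config) s :
  q.2 s @[q --> p] --> p.2 s.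
Proof.
apply: (@cvg_comp _ _ _ snd (fun c : config => c s)); first exact: cvg_snd.
exact: ptws_eval_continuous.
Qed.

Let config_dist_cvg (p : closed_subgroup G * config) s s' :
  `|q.2 s - q.2 s'|%R @[q --> p] --> `|p.2 s - p.2 s'|%R.
Proof.
apply: (@cvg_norm R R^o _ (nbhs p)); apply: (@cvgB R R^o _ (nbhs p)).
  exact: config_eval_cvg.
exact: config_eval_cvg.
Qed.

Let config_dist_lt (p : closed_subgroup G * config) s s' r :
  (`|p.2 s - p.2 s'| < r)%R -> \forall q \near p, (`|q.2 s - q.2 s'| < r)%R.
Proof.
move=> pr.
exact: (@cvgr_lt R _ (nbhs p) _ _ _ (@config_dist_cvg p s s') r pr).
Qed.

Let config_dist_gt (p : closed_subgroup G * config) s s' r :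
  (r < `|p.2 s - p.2 s'|)%R -> \forall q \near p, (r < `|q.2 s - q.2 s'|)%R.
Proof.
move=> pr.
exact: (@cvgr_gt R _ (nbhs p) _ _ _ (@config_dist_cvg p s s') r pr).
Qed.

(** A clause failing at [p] would fail at nearby members of [configs]. Invariance uses hit sets and
    [rho]; separation uses miss sets of compact sets and the finiteness of the set of colours. *)
Lemma configs_closed : closed configs.
Proof.
move=> p clp.
have clqP B : nbhs p B -> exists q, [/\ HH q.1, left_equivariant q.1 q.2 & B q].
  by move=> /clp[q [[? ?] ?]]; exists q.
split; [|split].
- apply: clHH => B Bp; have [|q [Hq _ Bq]] := clqP (fst @^-1` B).
    exact: cvg_fst Bp.
  by exists q.1.
- move=> s; apply/andP; split; rewrite leNgt; apply/negP => ps.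
    have [q [_ [q01 _ _ _]]] :=
      clqP _ (@cvgr_lt R _ (nbhs p) _ _ _ (@config_eval_cvg p s) _ ps).
    by have /andP[q0 _] := q01 s; rewrite ltNge q0.
  have [q [_ [q01 _ _ _]]] :=
    clqP _ (@cvgr_gt R _ (nbhs p) _ _ _ (@config_eval_cvg p s) _ ps).
  by have /andP[_ q1] := q01 s; rewrite ltNge q1.
- move=> t i x u; rewrite leNgt; apply/negP => pd.
  have [q [_ [_ qlip _ _]]] := clqP _ (config_dist_gt pd).
  by rewrite ltNge qlip.
- move=> t i h x ph; apply/eqP/negPn/negP; rewrite -subr_eq0 -normr_gt0 => pd.
  set d := `|_|%R in pd.
  have d2 : (d / 2 < d)%R by lra.
  (* For [v] in [V], passing from [v * x] to [h * x] changes a colour of index [t] by less than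
     [d / 2]. *)
  pose V := [set v : G | (rho t ((v * x)^-1 * (h * x))%g < d / 2)%R].
  have Vh : nbhs h V.
    have : rho t ((v * x)^-1 * (h * x)) @[v --> h] --> 0%R.
      apply: (@cvg_comp _ _ _ (fun v => (v * x)^-1 * (h * x)) (rho t));
        last exact: rho0.
      rewrite -(mulVg (h * x)); apply: cvgMg; last exact: cvg_cst.
      by apply: cvgVg; apply: cvgMg; [exact: cvg_id|exact: cvg_cst].
    by move/cvgr_lt; apply; lra.
  have Bp : nbhs p (fst @^-1` (chabauty_hit V°)).
    apply: cvg_fst; apply: open_nbhs_nbhs; split.
      by apply: open_chabauty_hit; exact: open_interior.
    by exists h.
  have [q [_ [_ qlip qinv _]]] := clqP _ (filterI Bp (config_dist_gt d2)).
  (* The points v of q.1 close to h replace h, which need not lie in q.1. *)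
  case=> -[v [qv /interior_subset Vv]].
  rewrite -(qinv t i v x qv) ltNge => /negP; apply.
  have := qlip t i (v * x)%g ((v * x)^-1 * (h * x))%g.
  rewrite mulgA mulgV mul1g => /le_trans.
  by apply; exact: ltW.
- move=> t x pL; apply: contrapT => /forallNP noi.
  have /choice[k kP] (i : 'I_(N t)) : exists k, K t k /\
      (`|p.2 (t, val i, (x * k)%g) - p.2 (t, val i, x)| < 1 / 2)%R.
    have /existsNP[k /not_implyP[Kk /negP]] := noi i.
    by rewrite -ltNge => ?; exists k.
  (* [C] is [x L x^-1]: missing it is exactly the premise of the separation clause. *)
  pose C := [set z.1 * z.2 | z in
    [set z.1 * z.2 | z in [set x] `*` L t] `*` [set x^-1]].
  have cC : compact C.
    apply: compact_mul; last exact: compact_set1.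
    by apply: compact_mul; [exact: compact_set1|exact: compactL].
  have Bp : nbhs p (fst @^-1` (chabauty_miss C)).
    apply: cvg_fst; apply: open_nbhs_nbhs.
    split; first exact: open_chabauty_miss.
    rewrite /chabauty_miss/= -subset0 => h.
    case=> ph [[_ _] [[[_ l] [/= -> Ll] <-] /= ->] hE].
    by apply: (pL h ph); rewrite -hE !mulgA mulVg mul1g mulgVK.
  pose D (i : 'I_(N t)) (q : closed_subgroup G * config) :=
    (`|q.2 (t, val i, (x * k i)%g) - q.2 (t, val i, x)| < 1 / 2)%R.
  have Dp : nbhs p (fun q => forall i, D i q).
    apply: (@filter_forall _ _ D (nbhs p) _) => i.
    exact: config_dist_lt (kP i).2.
  have [q [_ [_ _ _ qsep] [/= qC qD]]] := clqP _ (filterI Bp Dp).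
  have [|i qi] := qsep t x.
    move=> h qh Lh; suff : set0 h by [].
    rewrite -qC; split=> //; exists (x * (x^-1 * h * x), x^-1);
      last by rewrite /= !mulgA mulgV mul1g mulgK.
    by split=> //; exists (x, x^-1 * h * x).
  by have := qD i; rewrite /D ltNge (qi _ (kP i).1).
Qed.

Lemma configs_compact : compact configs.
Proof.
have cB : compact ([set: closed_subgroup G] `*`
    [set c : config | forall s, `[0%R, 1%R]%classic (c s)]).
  apply: compact_setX; first exact: chabauty_compact.
  apply: (@tychonoff (T * nat * G)%type (fun=> R : topologicalType)
    (fun=> `[0%R, 1%R]%classic)).
  by move=> _; exact: segment_compact.
apply: subclosed_compact cB _; first exact: configs_closed.
by move=> [H c] [_ [c01 _ _ _]]; split=> //= s; rewrite in_itv/=.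
Qed.

End configurations.

(** * Left translation and stabilizers *)

Lemma closed_subgroup_ext (G : topologicalGroupType) (H K : closed_subgroup G) :
  H = K :> set G -> H = K.
Proof.
case: H K => [H H1 HM HV Hcl] [K K1 KM KV Kcl] /= HK; subst K.
by congr ClosedSubgroup; exact: Prop_irrelevance.
Qed.

Section flow.
Context {R : realType} {G : topologicalGroupType} {T : choiceType}.
Variables (rho : T -> G -> R) (N : T -> nat) (K L : T -> set G).
Hypothesis rho0 : forall t, rho t u @[u --> (1 : G)] --> 0%R.
Hypothesis compactL : forall t, compact (L t).
Hypothesis KLfine : forall (g : G) U, nbhs g U -> exists t, K t g /\ L t `<=` U.
Variables (HH : set (closed_subgroup G)).
Hypotheses (clHH : closed HH) (invHH : conj_invariant HH).
Hypothesis colorable : forall H : closed_subgroup G,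
  exists c : config, left_equivariant rho N K L H c.

(** The subgroup is forgotten; [shift_stab] recovers it as the stabilizer of the colouring. *)
Definition colorings : set (@config R G T) :=
  [set p.2 | p in configs rho N K L HH].

Lemma coloringP (x : colorings) :
  exists2 H, HH H & left_equivariant rho N K L H (\val x).
Proof.
have [[H c] [/= HHH Hc] xE] := set_valP x.
by exists H => //; rewrite -xE.
Qed.

Lemma colorings_lipschitz (x : colorings) t i z u :
  (`|\val x (t, i, (z * u)%g) - \val x (t, i, z)| <= rho t u)%R.
Proof. by have [H _ [_ xlip _ _]] := coloringP x; exact: xlip. Qed.

Lemma colorings_hausdorff : hausdorff_space colorings.
Proof.
apply: subtype_hausdorff.
exact: (@hausdorff_product (T * nat * G)%type (fun=> R : topologicalType)
  (fun=> @Rhausdorff R)).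
Qed.

Lemma colorings_compact : compact [set: colorings].
Proof.
apply: subtype_compact; apply: continuous_compact.
  by apply: continuous_subspaceT => p; exact: cvg_snd.
exact: configs_compact.
Qed.

Lemma colorings_shift g (x : colorings) : colorings (shift_config g (\val x)).
Proof.
have [H HHH Hx] := coloringP x.
exists (conj_subgroup g H, shift_config g (\val x)) => //.
by split; [exact: invHH|exact: left_equivariant_shift].
Qed.

Definition shift g (x : colorings) : colorings :=
  SigSub (mem_set (colorings_shift g x)).

Lemma shift1 x : shift 1 x = x.
Proof.
apply/val_inj/funext => -[[t i] z].
by rewrite /= /shift_config/= invg1 mul1g.
Qed.

Lemma shiftM g h x : shift (g * h) x = shift g (shift h x).
Proof.
apply/val_inj/funext => -[[t i] z].
by rewrite /= /shift_config/= invgM mulgA.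
Qed.

Lemma colorings_eval_continuous s : continuous (fun x : colorings => \val x s).
Proof.
move=> x; apply: (@cvg_comp _ _ _ (fun x : colorings => \val x)
  (fun c : config => c s)); first exact: subtype_val_continuous.
exact: ptws_eval_continuous.
Qed.

(** Evaluation at the fixed point [g^-1 * z] handles the change of colouring; [rho], common to all
    colourings, handles the move to [h^-1 * z]. *)
Lemma shift_continuous : continuous (fun p : G * colorings => shift p.1 p.2).
Proof.
apply: continuous_subtype; apply: continuous_ptws => -[[t i] z] [g x] /=.
rewrite /shift_config/=; apply/cvgrPdist_lt => e e0.
have e2 : (0 < e / 2)%R by rewrite divr_gt0.
have near1 : \forall p \near (g, x),
    (`|\val x (t, i, (g^-1 * z)%g) - \val p.2 (t, i, (g^-1 * z)%g)| < e / 2)%R.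
  have : \val p.2 (t, i, g^-1 * z) @[p --> (g, x)] --> \val x (t, i, g^-1 * z).
    apply: (@cvg_comp _ _ _ snd (fun y : colorings => \val y (t, i, g^-1 * z))).
      exact: cvg_snd.
    exact: colorings_eval_continuous.
  by move=> /cvgrPdist_lt/(_ _ e2).
have near2 : \forall p \near (g, x),
    (rho t ((g^-1 * z)^-1 * (p.1^-1 * z))%g < e / 2)%R.
  have : rho t ((g^-1 * z)^-1 * (p.1^-1 * z)) @[p --> (g, x)] --> 0%R.
    apply: (@cvg_comp _ _ _ (fun p : G * colorings =>
      (g^-1 * z)^-1 * (p.1^-1 * z)) (rho t)); last exact: rho0.
    rewrite -(mulVg (g^-1 * z)); apply: cvgMg; first exact: cvg_cst.
    apply: cvgMg; last exact: cvg_cst.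
    by apply: cvgVg; exact: cvg_fst.
  by move=> cv; exact: (@cvgr_lt R _ (nbhs (g, x)) _ _ _ cv _ e2).
apply: filterS2 near1 near2 => -[h y] /= h1 h2.
have := colorings_lipschitz y t i (g^-1 * z) ((g^-1 * z)^-1 * (h^-1 * z)).
rewrite mulgA mulgV mul1g => h3.
rewrite [ltRHS](splitr e) -(subrKA (\val y (t, i, (g^-1 * z)%g))).
apply: le_lt_trans (ler_normD _ _) _; apply: ltrD => //.
by rewrite distrC; exact: le_lt_trans h3 h2.
Qed.

Definition shift_action : continuous_action G colorings :=
  ContinuousAction shift1 shiftM shift_continuous.

Lemma shift_stab (x : colorings) H : left_equivariant rho N K L H (\val x) ->
  stab colorings_hausdorff shift_action x = H.
Proof.
move=> Hx; apply: closed_subgroup_ext; apply/seteqP; split=> g /=.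
  move=> gx; apply/(left_equivariant_stab KLfine g Hx) => t i z.
  by rewrite -[in RHS]gx.
move=> /(left_equivariant_stab KLfine g Hx) gx.
by apply/val_inj/funext => -[[t i] z]; exact: gx.
Qed.

Lemma shift_stab_range :
  range (stab colorings_hausdorff shift_action) = HH.
Proof.
apply/seteqP; split=> [_ [x _ <-]|H HHH].
  by have [H HHH /shift_stab ->] := coloringP x.
have [c Hc] := colorable H.
have xc : colorings c by exists (H, c).
by exists (SigSub (mem_set xc)) => //; exact: shift_stab.
Qed.

(** The preimage of a closed [Z] is the projection of a closed part of the compact set [configs],
    hence compact and so closed. *)
Lemma shift_stab_continuous :
  continuous (stab colorings_hausdorff shift_action).
Proof.
apply/continuous_closedP => Z clZ.
have -> : stab colorings_hausdorff shift_action @^-1` Z =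
    (fun x : colorings => \val x) @^-1`
      [set p.2 | p in configs rho N K L HH `&` fst @^-1` Z].
  apply/seteqP; split=> x /=.
    have [H HHH Hx] := coloringP x; rewrite (shift_stab Hx) => ZH.
    by exists (H, \val x).
  move=> [[H c] [[/= _ Hc] ZH] cx]; rewrite cx in Hc.
  by rewrite (shift_stab Hc).
apply: preimage_closed; first by move=> x _; exact: subtype_val_continuous.
apply: compact_closed.
  exact: (@hausdorff_product (T * nat * G)%type (fun=> R : topologicalType)
    (fun=> @Rhausdorff R)).
apply: continuous_compact.
  by apply: continuous_subspaceT => p; exact: cvg_snd.
apply: compact_closedI; first exact: configs_compact.
by apply: preimage_closed => // p _; exact: cvg_fst.
Qed.

End flow.

(** * Metrizability *)

Section separating_sequence.
Context {R : realType} {X : topologicalType}.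
Variable e : nat -> X -> R.
Hypothesis e01 : forall n x, (0 <= e n x <= 1)%R.
Hypothesis e_sep : forall x y, (forall n, e n x = e n y) -> x = y.

(** Weights tending to 0 leave only finitely many coordinates to control at each scale. *)
Let dist_set x y : set R := [set `|e n x - e n y|%R / n.+1%:R | n in setT]%R.

Let dist x y : R := sup (dist_set x y).

Let le_dist x y n : (`|e n x - e n y| / n.+1%:R <= dist x y)%R.
Proof.
apply: ub_le_sup; last by exists n.
exists 1%R => _ [m _ <-]; rewrite ler_pdivrMr ?ltr0n// mul1r.
apply: (@le_trans _ _ 1%R); last by rewrite ler1n.
have /andP[? ?] := e01 m x; have /andP[? ?] := e01 m y.
by rewrite ler_norml; apply/andP; split; lra.
Qed.

Let dist_le x y r : (forall n, `|e n x - e n y| / n.+1%:R <= r)%R ->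
  (dist x y <= r)%R.
Proof.
move=> er; apply: ge_sup; first by exists (`|e 0 x - e 0 y| / 1%:R)%R, 0.
by move=> _ [n _ <-].
Qed.

Let distxx x : dist x x = 0%R.
Proof.
apply/eqP; rewrite eq_le; apply/andP; split.
  by apply: dist_le => n; rewrite subrr normr0 mul0r.
by apply: le_trans (le_dist x x 0); rewrite subrr normr0 mul0r.
Qed.

Let dist_positivity x y : dist x y = 0%R -> x = y.
Proof.
move=> xy; apply: e_sep => n; apply/eqP; rewrite -subr_eq0 -normr_le0.
have := le_dist x y n; rewrite xy ler_pdivrMr ?ltr0n//.
by rewrite mul0r.
Qed.

Let dist_sym x y : dist x y = dist y x.
Proof.
by congr sup; apply/seteqP; split=> _ [n _ <-]; exists n => //; rewrite distrC.
Qed.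

Let dist_triangle y x z : (dist x z <= dist x y + dist y z)%R.
Proof.
apply: dist_le => n; apply: le_trans (lerD (le_dist x y n) (le_dist y z n)).
by rewrite -mulrDl ler_pM2r ?invr_gt0 ?ltr0n// ler_distD.
Qed.

(** The [let] makes the alias depend on both hypotheses, from which its metric is built. *)
Definition separated_metric : Type := let _ := (e01, e_sep) in X.

HB.instance Definition _ := Choice.copy separated_metric X.
HB.instance Definition _ := isMetric.Build R separated_metric
  distxx dist_positivity dist_sym dist_triangle.

(** The identity onto the metric space is a continuous bijection from a compact space to a Hausdorff
    one. *)
Lemma compact_metrizable : compact [set: X] -> (forall n, continuous (e n)) ->
  metrizable R X.
Proof.
move=> cX ce; pose f : X -> separated_metric := id.
have cf : continuous f.
  move=> x; apply/(@metricType_numDomainType.cvgrPdist_lt R separated_metric).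
  move=> r r0; have r2 : (0 < r / 2)%R by rewrite divr_gt0.
  (* From index [m] on, the weights are below [r / 2]. *)
  have [m] := ltr_add_invr r2; rewrite add0r => mr.
  have near_e : \forall y \near x, forall n : 'I_m,
      (`|e n x - e n y| < r / 2)%R.
    apply: filter_forall => n; have /cvgrPdist_lt := ce n x.
    by move=> /(_ _ r2).
  apply: filterS near_e => y xy.
  apply: (@le_lt_trans _ _ (r / 2)%R); last by lra.
  apply: dist_le => n; have [nm|mn] := ltnP n m.
    rewrite ler_pdivrMr ?ltr0n//; apply: le_trans (ltW (xy (Ordinal nm))) _.
    by rewrite ler_pMr// ler1n.
  apply: le_trans (ltW mr); rewrite -[leRHS]mul1r ler_pM ?invr_ge0//.
    have /andP[? ?] := e01 n x; have /andP[? ?] := e01 n y.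
    by rewrite ler_norml; apply/andP; split; lra.
  by rewrite lef_pV2 ?posrE ?ltr0n// ler_nat.
exists separated_metric, f, id; split=> //.
apply/continuous_closedP => Z clZ.
have -> : id @^-1` Z = f @` Z.
  by apply/seteqP; split=> [z Zz|_ [z Zz <-]//]; exists z.
apply: compact_closed; first exact: metric_hausdorff.
apply: continuous_compact; first exact: continuous_subspaceT.
exact: subclosed_compact clZ cX _.
Qed.

End separating_sequence.

(** * Choice of the pairs of compact sets *)

Section compact_pairs.
Context {R : realType} {G : topologicalGroupType}.
Hypotheses (hausG : hausdorff_space G) (lcG : locally_compact [set: G]).

Definition compact_pair (P Q : set G) :=
  [/\ compact P, compact Q & forall k, P k -> nbhs k Q].

Lemma exists_colorable (T : choiceType) (P Q : T -> set G) :
  (forall (g : G) U, nbhs g U ->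
    exists t, [/\ compact_pair (P t) (Q t), P t g & Q t `<=` U]) ->
  exists (rho : T -> G -> R) (N : T -> nat) (K L : T -> set G),
  [/\ forall t, rho t u @[u --> (1 : G)] --> 0%R,
      forall t, compact (L t),
      forall (g : G) U, nbhs g U -> exists t, K t g /\ L t `<=` U &
      forall H : closed_subgroup G,
        exists c : config, left_equivariant rho N K L H c].
Proof.
(* Indices that do not give a compact pair receive two empty sets, which form one; every index then
   has a colouring. *)
move=> fine; pose good t := `[< compact_pair (P t) (Q t) >].
pose K t := if good t then P t else set0.
pose L t := if good t then Q t else set0.
have KLpair t : compact_pair (K t) (L t).
  rewrite /K /L; case: ifPn => [/asboolP//|_].
  by split=> //; exact: compact0.
have /choice[rho /choice[N rhoN]] :
    forall t, exists rho : G -> R, exists N : nat, _ :=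
      fun t => let: And3 cK _ KL := KLpair t in
      @exists_left_coloring R G hausG lcG (K t) (L t) cK KL.
exists rho, N, K, L; split=> [t|t|g U gU|H].
- by have [] := rhoN t.
- by have [] := KLpair t.
- have [t [PQ Pg QU]] := fine g U gU; exists t.
  by rewrite /K /L /good asboolT.
have /choice[c cP] := fun t => (rhoN t).2 H.
exists (fun s => c s.1.1 s.1.2 s.2); split=> /= [[[t i] x]|t|t|t].
- by have [+ _ _ _] := cP t; apply.
- by have [_ + _ _] := cP t; apply.
- by have [_ _ + _] := cP t; apply.
- by have [_ _ _ +] := cP t; apply.
Qed.

Lemma compact_pair_fine (g : G) U : nbhs g U ->
  exists t : set G * set G, [/\ compact_pair t.1 t.2, t.1 g & t.2 `<=` U].
Proof.
move=> gU; have [C [cC Cg CU]] := compact_nbhs_in hausG lcG gU.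
exists ([set g], C); split=> //; split=> //=; first exact: compact_set1.
by move=> _ ->.
Qed.

Section second_countable.
Variable b : nat -> set G.
Hypothesis b_basis : forall (g : G) U, nbhs g U ->
  exists n, [/\ open (b n), b n g & b n `<=` U].

(** Shrinking twice puts the closure of [b m] inside the open set [b n], so countably many pairs of
    closures suffice. *)
Lemma basis_compact_pair_fine (g : G) U : nbhs g U ->
  exists t : nat * nat, [/\ compact_pair (closure (b t.1)) (closure (b t.2)),
    closure (b t.1) g & closure (b t.2) `<=` U].
Proof.
have shrink V : nbhs g V -> exists n, [/\ open (b n), b n g,
    compact (closure (b n)) & closure (b n) `<=` V].
  move=> gV; have [C [cC Cg CV]] := compact_nbhs_in hausG lcG gV.
  have [n [on ng nC]] := b_basis Cg.
  have clC : closure (b n) `<=` C.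
    by rewrite [C](closure_id _).1; [exact: closureS|exact: compact_closed].
  exists n; split=> //; last exact: subset_trans clC CV.
  by apply: subclosed_compact cC _; [exact: closed_closure|].
move=> /shrink[n [on ng cn nU]].
have [m [om mg cm mn]] := shrink _ (open_nbhs_nbhs (conj on ng)).
exists (m, n); split=> //=; last exact: subset_closure.
split=> // k /mn nk; apply: filterS (@subset_closure _ (b n)) _.
exact: open_nbhs_nbhs.
Qed.

Variables (rho : nat * nat -> G -> R) (N : nat * nat -> nat).
Variables (K L : nat * nat -> set G) (HH : set (closed_subgroup G)).
Hypothesis rho0 : forall t, rho t u @[u --> (1 : G)] --> 0%R.

Lemma colorings_metrizable : compact [set: colorings rho N K L HH] ->
  metrizable R (colorings rho N K L HH).
Proof.
move=> cX.
(* A dense sequence; the default 1 is taken where [b n] is empty. *)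
pose d n : G := xget 1 (b n).
pose index n : nat * nat * nat * nat := odflt (0, 0, 0, 0) (choice.unpickle n).
pose e n (x : colorings rho N K L HH) : R :=
  let s := index n in \val x (s.1, d s.2).
apply: (@compact_metrizable R _ e) => //.
- by move=> n x; have [H _ [x01 _ _ _]] := coloringP x; exact: x01.
- move=> x y xy; apply/val_inj/funext => -[[t i] z].
  have xyd k : \val x (t, i, d k) = \val y (t, i, d k).
    by have := xy (choice.pickle (t, i, k)); rewrite /e /index choice.pickleK.
  (* Colourings that agree at a point [d k] near [z] differ at [z] by at most twice the modulus,
     hence by less than any [r]. *)
  apply/eqP; rewrite -subr_eq0 -normr_le0; apply/ler_addgt0Pl => r r0.
  have r2 : (0 < r / 2)%R by rewrite divr_gt0.
  have : \forall w \near z, (rho t (z^-1 * w)%g < r / 2)%R.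
    have cv : rho t (z^-1 * w) @[w --> z] --> 0%R.
      apply: (@cvg_comp _ _ _ (fun w => z^-1 * w) (rho t)); last exact: rho0.
      by rewrite -(mulVg z); apply: cvgMg; [exact: cvg_cst|exact: cvg_id].
    exact: (@cvgr_lt R _ (nbhs z) _ _ _ cv _ r2).
  move=> /b_basis[k [_ kz kr]].
  have dk : b k (d k) by apply: xgetPex; exists z.
  have xd := colorings_lipschitz x t i z (z^-1 * d k).
  have yd := colorings_lipschitz y t i z (z^-1 * d k).
  have tri (u v w s : R) : (`|w - u| <= s -> `|w - v| <= s -> s < r / 2 ->
      `|u - v| <= r + 0)%R.
    by rewrite !ler_norml => /andP[? ?] /andP[? ?] ?; apply/andP; split; lra.
  move: xd yd; rewrite mulgA mulgV mul1g xyd => xd yd.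
  exact: tri _ _ _ _ xd yd (kr _ dk).
- by move=> n; exact: colorings_eval_continuous.
Qed.

End second_countable.

End compact_pairs.

Lemma second_countable_basis_seq (X : topologicalType) :
  @second_countable X -> exists b : nat -> set X, forall (x : X) U, nbhs x U ->
    exists n, [/\ open (b n), b n x & b n `<=` U].
Proof.
move=> [B /countable_injP[f finj] [Bopen Bbasis]].
(* Numbers that are not the code of a basic set give [set0]. *)
exists (fun n => xget set0 [set V | B V /\ f V = n]) => x U xU.
have [V [BV Vx] VU] := Bbasis x U xU.
exists (f V); have -> // : xget set0 [set W | B W /\ f W = f V] = V.
  have [BW fW] := xgetPex set0 (P := [set W | B W /\ f W = f V])
    (ex_intro _ V (conj BV erefl)).
  by apply: finj => //; exact: mem_set.
by split=> //; exact: Bopen.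
Qed.

Theorem theorem1p1 (R : realType) (G : topologicalGroupType)
    (hausG : hausdorff_space G) (lcG : locally_compact [set: G])
    (HH : set (closed_subgroup G))
    (clHH : closed HH) (invHH : conj_invariant HH) :
  (exists (X : topologicalType) (hausX : hausdorff_space X)
     (a : continuous_action G X),
     [/\ compact [set: X], continuous (stab hausX a)
       & range (stab hausX a) = HH]) /\
  (@second_countable G ->
   exists (X : topologicalType) (hausX : hausdorff_space X)
     (a : continuous_action G X),
     [/\ compact [set: X], metrizable R X, continuous (stab hausX a)
       & range (stab hausX a) = HH]).
Proof.
split=> [|/second_countable_basis_seq[b b_basis]].
  (* Here the indices are all pairs of subsets of [G]. *)
  have [rho [N [K [L [rho0 cL fine col]]]]] :=
    exists_colorable (R := R) hausG lcG (compact_pair_fine hausG lcG).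
  exists (colorings rho N K L HH), (@colorings_hausdorff _ _ _ rho N K L HH),
    (shift_action N K L rho0 invHH); split.
  - exact: colorings_compact.
  - exact: shift_stab_continuous.
  - exact: shift_stab_range.
(* Here the indices are pairs of naturals, as metrizability requires countably many coordinates. *)
have [rho [N [K [L [rho0 cL fine col]]]]] :=
  exists_colorable (R := R) hausG lcG
    (basis_compact_pair_fine hausG lcG b_basis).
have cX := colorings_compact (N := N) (K := K) rho0 cL clHH.
exists (colorings rho N K L HH), (@colorings_hausdorff _ _ _ rho N K L HH),
  (shift_action N K L rho0 invHH); split=> //.
- exact: (colorings_metrizable b_basis).
- exact: shift_stab_continuous.
- exact: shift_stab_range.
Qed.
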